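(* Let $G$ be a finite simple $2$-edge connected graph and let $v \in V(G)$ with $d(v) \geq 3$. Then $v$ is contained in a circuit of even length.
   Context: Graphs are finite, simple (no loops, no multiple edges). $d(v)$ denotes the degree of $v$. A graph is $2$-edge connected if it is connected and remains connected whenever fewer than $2$ edges are removed. A walk is a sequence $v_0, e_1, v_1, \ldots, e_k, v_k$ of vertices and edges with $e_i$ having endpoints $v_{i-1}, v_i$; a trail is a walk with no repeated edge; a circuit is a trail whose first and last vertices coincide (vertices may repeat). The length of a circuit is its number of edges. *)

(* Defs.v *)
From mathcomp Require Import all_boot.

Set Implicit Arguments.
Unset Strict Implicit.
Unset Printing Implicit Defensive.

(* A finite simple graph is a finite type T of vertices together with a
   symmetric and irreflexive adjacency relation e : rel T. *)
Definition simple_graph (T : finType) (e : rel T) : Prop :=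
  symmetric e /\ irreflexive e.

Definition degree (T : finType) (e : rel T) (v : T) : nat := #|[set w | e v w]|.

(* An edge is the two-element set of its endpoints. *)
Definition edges (T : finType) (e : rel T) : {set {set T}} :=
  [set [set p.1; p.2] | p : T * T & e p.1 p.2].

Definition remove_edges (T : finType) (e : rel T) (F : {set {set T}}) : rel T :=
  [rel x y | e x y && ([set x; y] \notin F)].

Definition connected_graph (T : finType) (e : rel T) : Prop :=
  forall x y : T, connect e x y.

Definition edge_connected (k : nat) (T : finType) (e : rel T) : Prop :=
  connected_graph e /\
  forall F : {set {set T}}, F \subset edges e -> #|F| < k ->
    connected_graph (remove_edges e F).

(* The walk v_0, e_1, v_1, ..., e_k, v_k is represented by its first vertex v_0
   and the sequence s = [:: (e_1, v_1); ...; (e_k, v_k)], so that its length is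
   size s. *)
Fixpoint walk (T : finType) (e : rel T) (x : T) (s : seq ({set T} * T)) : bool :=
  if s is (f, y) :: s' then
    [&& f \in edges e, f == [set x; y] & walk e y s']
  else true.

Definition walk_vertices (T : finType) (x : T) (s : seq ({set T} * T)) : seq T :=
  x :: unzip2 s.

Definition walk_edges (T : finType) (s : seq ({set T} * T)) : seq {set T} :=
  unzip1 s.

Definition trail (T : finType) (e : rel T) (x : T) (s : seq ({set T} * T)) : bool :=
  walk e x s && uniq (walk_edges s).

(* The one-vertex walk (s = [::]) also satisfies this definition; statements
   about genuine circuits must add 0 < size s. *)
Definition circuit (T : finType) (e : rel T) (x : T) (s : seq ({set T} * T)) : bool :=
  trail e x s && (last x (unzip2 s) == x).

(* Main.v *)
(** Since no edge at [v] is a bridge, [v] lies on a cycle [C]; assume that [C]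
is odd.  As [d(v) >= 3], some edge [vw] is not in [C], and it is not a bridge
either, so it extends to a trail [P] from [v] that stops at the first vertex [u]
of [C] it meets; [P] shares no edge with [C].  Splitting [C] at [u] into two
trails [A], [B] between [u] and [v] of different parities (one of them is
empty when [u = v]), exactly one of the circuits [P A], [P B] is even. *)
Require Import Defs.
From mathcomp Require Import all_boot.

Set Implicit Arguments.
Unset Strict Implicit.
Unset Printing Implicit Defensive.

Section VertexPaths.

Variable T : finType.
Implicit Types (e : rel T) (x y z : T) (p : seq T).

(** In a simple graph the vertices determine the edges, so trails are handled as vertex sequences;
    [zip (path_edges x p) p] restores the format of [walk]. *)
Definition path_edges x p : seq {set T} := pairmap (fun a b => [set a; b]) x p.

Lemma path_edges_cat x p1 p2 :
  path_edges x (p1 ++ p2) = path_edges x p1 ++ path_edges (last x p1) p2.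
Proof. exact: pairmap_cat. Qed.

Lemma path_edges_rev x p :
  path_edges (last x p) (rev (belast x p)) = rev (path_edges x p).
Proof.
elim/last_ind: p => [//|p y IHp].
rewrite last_rcons belast_rcons -cats1 path_edges_cat rev_cat -IHp.
by rewrite lastI rev_rcons /= setUC.
Qed.

Lemma path_edges_sub x p f : f \in path_edges x p -> {subset f <= x :: p}.
Proof.
elim: p x => [//|y p IHp] x; rewrite inE => /predU1P[-> z|/IHp fp z /fp].
  by rewrite !inE => /orP[]->; rewrite ?orbT.
by rewrite !inE => ->; rewrite orbT.
Qed.

(** The first edge contains [x], which no later edge meets. *)
Lemma uniq_path_edges x p : uniq (x :: p) -> uniq (path_edges x p).
Proof.
elim: p x => [//|y p IHp] x /andP[xNp /IHp /= ->]; rewrite andbT.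
by apply: contra xNp => /path_edges_sub; apply; rewrite set21.
Qed.

(** This serves to show that a path whose interior avoids a trail shares no edge with it. A single
    edge has no interior vertex, hence [p != [::]]. *)
Lemma path_edges_rcons_interior x p y f :
  p != [::] -> f \in path_edges x (rcons p y) -> exists2 z, z \in p & z \in f.
Proof.
elim: p x => [//|z p IHp] x _; rewrite inE => /predU1P[->|].
  by exists z; rewrite ?mem_head ?set22.
case: p IHp => [_|t p /(_ z isT) IHp fP].
  by rewrite inE => /eqP ->; exists z; rewrite ?mem_head ?set21.
by have [s sp sf] := IHp fP; exists s; rewrite // inE sp orbT.
Qed.

Lemma edge_in_edges e x y : e x y -> [set x; y] \in edges e.
Proof. by move=> exy; apply/imsetP; exists (x, y); rewrite ?inE. Qed.

Lemma walk_of_path e x p : path e x p -> walk e x (zip (path_edges x p) p).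
Proof.
elim: p x => [//|y p IHp] x /= /andP[exy /IHp ->]; rewrite eqxx !andbT.
exact: edge_in_edges.
Qed.

Lemma circuit_of_path e x p :
    path e x p -> uniq (path_edges x p) -> last x p = x ->
  circuit e x (zip (path_edges x p) p).
Proof.
move=> xp Up px; have sz : size (path_edges x p) = size p by exact: size_pairmap.
rewrite /circuit /trail walk_of_path // /walk_edges unzip1_zip ?sz //.
by rewrite Up unzip2_zip ?sz // px eqxx.
Qed.

Lemma path_remove_edges e (F : {set {set T}}) x p :
  path (remove_edges e F) x p =
    path e x p && all [predC F] (path_edges x p).
Proof. by elim: p x => [//|y p IHp] x /=; rewrite IHp andbACA. Qed.

(** No edge is a bridge: deleting [[set x; y]] alone leaves [y] connected to [x], and the connecting
    path can be shortened to a simple one. *)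
Lemma path_avoiding_edge e x y : edge_connected 2 e -> e x y ->
  exists p, [/\ path e y p, last y p = x, uniq (y :: p)
              & [set x; y] \notin path_edges y p].
Proof.
move=> [_ conn] exy; pose F := [set [set x; y]].
have FE : F \subset edges e.
  by rewrite sub1set edge_in_edges.
have F1 : #|F| < 2 by rewrite cards1.
have /connectP[p0 p0P xE] := conn F FE F1 y x.
case/shortenP: p0P xE => p; rewrite path_remove_edges => /andP[yp pF] Up _ xE.
exists p; split=> //; apply/negP => /(allP pF) /=.
by rewrite !inE eqxx.
Qed.

End VertexPaths.

Theorem theorem8 (T : finType) (e : rel T) (v : T)
  (he : simple_graph e) (hconn : edge_connected 2 e) (hv : 3 <= degree e v) :
  exists (x : T) (s : seq ({set T} * T)),
    [/\ circuit e x s, v \in walk_vertices x s, 0 < size s & ~~ odd (size s)].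
Proof.
have [e_sym e_irr] := he.
suff [p [vp pv Up p_gt0 p_even]] : exists p,
    [/\ path e v p, last v p = v, uniq (path_edges v p), 0 < size p
      & ~~ odd (size p)].
  exists v, (zip (path_edges v p) p).
  rewrite size2_zip ?size_pairmap // mem_head.
  by split=> //; apply: circuit_of_path.
have neighbor_neq a : e v a -> a != v.
  by move=> va; apply: contraTneq va => ->; rewrite e_irr.
have [w0 vw0] : exists w0, e v w0.
  have /card_gt0P[w0] : 0 < #|[set w | e v w]| by exact: leq_trans hv.
  by rewrite inE; exists w0.
have [C [C_gt0 vC Cv UC [w vw vwNC]]] : exists C,
    [/\ 0 < size C, path e v C, last v C = v, uniq (path_edges v C)
      & exists2 w, e v w & [set v; w] \notin path_edges v C].
  have [c [w0c cv Uc vw0Nc]] := path_avoiding_edge hconn vw0.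
  exists (w0 :: c); split=> //=; rewrite ?vw0 ?vw0Nc ?uniq_path_edges //.
  case/lastP: c w0c cv Uc {vw0Nc} => [|c z] w0c.
    by move=> /= w0v; have := neighbor_neq _ vw0; rewrite w0v eqxx.
  rewrite last_rcons => zv; rewrite {z}zv in w0c *.
  rewrite -rcons_cons rcons_uniq => /andP[vNc _].
  (* The cycle leaves [v] through [w0] and returns through [last w0 c]; a third neighbor remains. *)
  pose N := [set w | e v w] :\ w0 :\ last w0 c.
  have /card_gt0P[w] : 0 < #|N|.
    move: hv; rewrite /degree (cardsD1 w0) (cardsD1 (last w0 c)) -/N.
    by case: (w0 \in _); case: (last w0 c \in _) => //; case: #|N|.
  rewrite !inE => /and3P[wNl wNw0 vw]; exists w => //.
  (* The edges of the cycle are the first, those inside [c], which avoid [v], and the last. *)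
  rewrite -cats1 path_edges_cat inE mem_cat mem_seq1 !negb_or.
  apply/and3P; split.
  - apply: contraNneq wNw0 => E; have : w \in [set v; w0] by rewrite -E set22.
    by rewrite !inE (negPf (neighbor_neq _ vw)).
  - by apply: contra vNc => /path_edges_sub; apply; rewrite set21.
  - apply: contraNneq wNl => E.
    have : w \in [set last w0 c; v] by rewrite -E set22.
    by rewrite !inE (negPf (neighbor_neq _ vw)) orbF.
have [C_odd|C_even] := boolP (odd (size C)); last by exists C.
have [q [wq qv Uq vwNq]] := path_avoiding_edge hconn vw.
have [u [p [uC vP UP PC]]] : exists u p, [/\ u \in v :: C, path e v (rcons p u),
    uniq (path_edges v (rcons p u))
  & ~~ has [in path_edges v C] (path_edges v (rcons p u))].
  (* A first meeting with the cycle exists because [q] returns to [v]. *)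
  have qC : has [in v :: C] (w :: q).
    by apply/hasP; exists v; rewrite ?mem_head // -qv mem_last.
  have vwq : path e v (w :: q) by rewrite /= vw.
  have Uvwq : uniq (path_edges v (w :: q)).
    by rewrite /= vwNq uniq_path_edges.
  (* Once [w :: q] is generalized to [r], this still records that the first edge is [vw]. *)
  have hd : head w (w :: q) = w by [].
  move: (w :: q) qC vwq Uvwq hd {wq qv Uq vwNq} => r.
  case/split_find=> u s1 s2 uC s1C.
  rewrite cat_path path_edges_cat cat_uniq => /andP[vs1 _] /and3P[Us1 _ _] hd.
  exists u, s1; split=> //; apply/hasPn => f fs1; apply/negP => fC.
  (* Either the trail is the edge [vw] alone, which is not in [C], or each of its edges has an
     interior vertex, which is off [C]. *)
  have [s1_0|s1_n0] := eqVneq s1 [::].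
    move: fs1 fC hd; rewrite s1_0 /= mem_seq1 => /eqP-> + uw.
    by rewrite uw (negPf vwNC).
  have [z zs1 zf] := path_edges_rcons_interior s1_n0 fs1.
  by case/hasP: s1C; exists z => //; apply: path_edges_sub fC _ zf.
(* Both arcs of [C] between [u] and [v] will be used as [r]. *)
have even_circuit (r : seq T) : path e u r -> last u r = v ->
    uniq (path_edges u r) -> {subset path_edges u r <= path_edges v C} ->
    ~~ odd (size (rcons p u) + size r) ->
  exists p0, [/\ path e v p0, last v p0 = v, uniq (path_edges v p0),
    0 < size p0 & ~~ odd (size p0)].
  move=> ur rv Ur rC pr_even; exists (rcons p u ++ r).
  rewrite cat_path path_edges_cat cat_uniq last_cat !last_rcons size_cat vP UP Ur.
  rewrite size_rcons in pr_even *; split=> //; rewrite andbT /=.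
  apply/hasPn => f /rC fC; apply: contra PC => fP.
  by apply/hasP; exists f.
case/splitPl: C / uC vC Cv UC C_odd {C_gt0 vwNC PC} even_circuit => A B Au.
rewrite cat_path last_cat path_edges_cat cat_uniq size_cat oddD Au.
move=> /andP[vA uB] Bv /and3P[UA _ UB] AB_odd even_circuit.
have [PB_odd|PB_even] := boolP (odd (size (rcons p u) + size B)); last first.
  by apply: (even_circuit B) => // f fB; rewrite mem_cat fB orbT.
(* The arc [A] runs from [v] to [u], so it is traversed backwards. *)
have rA : path_edges u (rev (belast v A)) = rev (path_edges v A).
  by rewrite -Au path_edges_rev.
apply: (even_circuit (rev (belast v A))).
- by rewrite -Au rev_path (eq_path (e' := e)).
- by case: (A) Au => [//|a A'] _; rewrite /= rev_cons last_rcons.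
- by rewrite rA rev_uniq.
- by move=> f; rewrite rA mem_rev mem_cat => ->.
(* The lengths of [PB] and [AB] are both odd, so [P] and [A] have equal parity. *)
- rewrite size_rev size_belast; move: PB_odd AB_odd; rewrite !oddD.
  by do 3!case: odd.
Qed.
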